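(* Let $(A,\alpha_A)$ be a Hom-associative (not necessarily commutative) algebra over a field $\mathbb{K}$ satisfying the $\alpha$-identity condition $[A,\operatorname{Im}(\alpha_A-\mathrm{id}_A)]=0$. Then there is an exact sequence of vector spaces $$A\ast HH_1^{\alpha}(A)\to\operatorname{Ker}\big(A\ast\mathbb{L}^{\alpha}(A)\to\mathbb{L}^{\alpha}(A)\big)\to\operatorname{Ker}\big(A\ast[A,A]\to[A,A]\big)\to HH_1^{\alpha}(A)\to HH_1^M(A,\alpha_A)\to[A,A]/[A,[A,A]]\to0.$$
   Context: Vector spaces and linear maps are over a fixed field $\mathbb{K}$. A Hom-Leibniz algebra $(L,\alpha_L)$ is a vector space $L$ with a bilinear bracket $[-,-]$ and a linear map $\alpha_L:L\to L$ such that $[\alpha_L(x),[y,z]]=[[x,y],\alpha_L(z)]-[[x,z],\alpha_L(y)]$ and $\alpha_L[x,y]=[\alpha_L(x),\alpha_L(y)]$ for all $x,y,z$. A (multiplicative) Hom-associative algebra $(A,\alpha_A)$ is a vector space $A$ with a bilinear product and a linear map $\alpha_A:A\to A$ such that $\alpha_A(a)(bc)=(ab)\alpha_A(c)$ and $\alpha_A(ab)=\alpha_A(a)\alpha_A(b)$. It is a Hom-Leibniz algebra with $[a,b]=ab-ba$. The $\alpha$-identity condition says that $ab-ba=0$ for all $a\in A$, $b\in\operatorname{Im}(\alpha_A-\mathrm{id}_A)$. $[A,A]$ is the span of all $ab-ba$, a Hom-Leibniz subalgebra of $A$, and $[A,[A,A]]$ is the span of brackets of elements of $A$ with elements of $[A,A]$.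 Let $b_3:A^{\otimes3}\to A^{\otimes2}$, $b_3(a\otimes b\otimes c)=ab\otimes\alpha_A(c)-\alpha_A(a)\otimes bc+ca\otimes\alpha_A(b)$. Put $\mathbb{L}^\alpha(A)=(A\otimes A)/\operatorname{Im}(b_3)$ and write $a\boxtimes b$ for the class of $a\otimes b$. It is a Hom-Leibniz algebra with $\overline\alpha_A(a\boxtimes b)=\alpha_A(a)\boxtimes\alpha_A(b)$ and $[a\boxtimes b,a'\boxtimes b']=[a,b]\boxtimes[a',b']$. $HH_1^\alpha(A)$, the first Hochschild homology of $(A,\alpha_A)$, is the kernel of $\phi:\mathbb{L}^\alpha(A)\to[A,A]$, $\phi(a\boxtimes b)=ab-ba$, considered as an abelian Hom-Leibniz algebra (zero bracket) with the restriction of $\overline\alpha_A$. The first Milnor-type Hochschild homology $HH_1^M(A,\alpha_A)$ is the quotient of $A\otimes A$ by the relations $ab\otimes\alpha_A(c)-\alpha_A(a)\otimes bc+ca\otimes\alpha_A(b)=0$, $\alpha_A(a)\otimes bc-\alpha_A(a)\otimes cb=0$, $ab\otimes\alpha_A(c)-ba\otimes\alpha_A(c)=0$ for all $a,b,c\in A$. Mutual actions. $A$ acts on $\mathbb{L}^\alpha(A)$ by ${}^{a'}(a\boxtimes b)=[a',a]\boxtimes\alpha_A(b)-[a',b]\boxtimes\alpha_A(a)$ and $(a\boxtimes b)^{a'}=[a,a']\boxtimes\alpha_A(b)+\alpha_A(a)\boxtimes[b,a']$; $\mathbb{L}^\alpha(A)$ acts on $A$ by ${}^{(a\boxtimes b)}a'=[[a,b],a']$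 and $a'^{(a\boxtimes b)}=[a',[a,b]]$. $A$ and $HH_1^\alpha(A)$ act on each other by the restrictions of these actions (which are trivial). $A$ and $[A,A]$ act on each other by the bracket of $A$ (${}^xy=[x,y]$, $x^y=[x,y]$). Non-abelian tensor product. For Hom-Leibniz algebras $(M,\alpha_M)$, $(N,\alpha_N)$ with compatible mutual actions $m^n,{}^nm\in M$ and ${}^mn,n^m\in N$, $M\ast N$ is the vector space spanned by all symbols $m\ast n$ and $n\ast m$ ($m\in M$, $n\in N$; the two kinds of symbols are formally distinct), bilinear in both arguments for each kind (so $M\ast N$ is a quotient of $(M\otimes N)\oplus(N\otimes M)$), subject to, for all $m,m'\in M$, $n,n'\in N$: $\alpha_M(m)\ast[n,n']=m^n\ast\alpha_N(n')-m^{n'}\ast\alpha_N(n)$; $\alpha_N(n)\ast[m,m']=n^m\ast\alpha_M(m')-n^{m'}\ast\alpha_M(m)$; $[m,m']\ast\alpha_N(n)={}^mn\ast\alpha_M(m')-\alpha_M(m)\ast n^{m'}$; $[n,n']\ast\alpha_M(m)={}^nm\ast\alpha_N(n')-\alpha_N(n)\ast m^{n'}$; $\alpha_M(m)\ast{}^{m'}n=-\alpha_M(m)\ast n^{m'}$; $\alpha_N(n)\ast{}^{n'}m=-\alpha_N(n)\ast m^{n'}$; $m^n\ast{}^{m'}n'={}^mn\ast m'^{\,n'}$; $m^n\ast n'^{\,m'}={}^mn\ast{}^{n'}m'$; ${}^nm\ast{}^{m'}n'=n^m\ast m'^{\,n'}$; ${}^nm\ast n'^{\,m'}=n^m\ast{}^{n'}m'$.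 The maps $A\ast N\to N$ whose kernels appear ($N=\mathbb{L}^\alpha(A)$ or $N=[A,A]$) are the homomorphisms given on generators by $a\ast n\mapsto{}^an$, $n\ast a\mapsto n^a$. *)

(* Defs.v *)
From HB Require Import structures.
From mathcomp Require Import all_boot all_algebra.
From mathcomp Require Import boolp.
From mathcomp Require Import freeg.

Set Implicit Arguments.
Unset Strict Implicit.
Unset Printing Implicit Defensive.

Import GRing.Theory.
Local Open Scope ring_scope.
Local Open Scope quotient_scope.

Lemma linear_forE (K : nzRingType) (U V : lmodType K) (f : {linear U -> V}) :
  linear f.
Proof. by move=> a x y; rewrite linearP. Qed.

Definition mkLinear (K : nzRingType) (U V : lmodType K) (f : U -> V)
    (f_lin : linear f) : {linear U -> V} :=
  HB.pack f (GRing.isLinear.Build K U V *:%R f f_lin).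

Definition mkBilinear (K : nzRingType) (U V W : lmodType K) (f : U -> V -> W)
    (f_linl : forall v, linear (f^~ v)) (f_linr : forall u, linear (f u)) :
    {bilinear U -> V -> W} :=
  HB.pack f (bilinear_isBilinear.Build K U V W *:%R *:%R f (f_linl, f_linr)).

Lemma mkLinearE (K : nzRingType) (U V : lmodType K) (f : U -> V)
  (f_lin : linear f) : mkLinear f_lin =1 f.
Proof. by []. Qed.

Lemma mkBilinearE (K : nzRingType) (U V W : lmodType K) (f : U -> V -> W)
  (f_linl : forall v, linear (f^~ v)) (f_linr : forall u, linear (f u)) u v :
  mkBilinear f_linl f_linr u v = f u v.
Proof. by []. Qed.

Section Composition.
Variables (K : nzRingType) (U V W U' V' W' : lmodType K).

Fact lcomp_linear (f : {linear V -> W}) (g : {linear U -> V}) :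
  linear (fun x => f (g x)).
Proof. by move=> a x y; rewrite !linearP. Qed.

Definition lcomp (f : {linear V -> W}) (g : {linear U -> V}) :
  {linear U -> W} := mkLinear (lcomp_linear f g).

Lemma lcompE f g x : lcomp f g x = f (g x). Proof. by []. Qed.

Variable f : {bilinear U -> V -> W}.

Fact bcomp_linl (g : {linear U' -> U}) (h : {linear V' -> V}) v :
  linear (fun u => f (g u) (h v)).
Proof. by move=> a x y; rewrite linearP linearPl. Qed.

Fact bcomp_linr (g : {linear U' -> U}) (h : {linear V' -> V}) u :
  linear (fun v => f (g u) (h v)).
Proof. by move=> a x y; rewrite linearP linearPr. Qed.

Definition bcomp (g : {linear U' -> U}) (h : {linear V' -> V}) :
    {bilinear U' -> V' -> W} :=
  mkBilinear (bcomp_linl g h) (bcomp_linr g h).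

Lemma bcompE g h u v : bcomp g h u v = f (g u) (h v). Proof. by []. Qed.

Fact bpost_linl (g : {linear W -> W'}) v : linear (fun u => g (f u v)).
Proof. by move=> a x y; rewrite linearPl linearP. Qed.

Fact bpost_linr (g : {linear W -> W'}) u : linear (fun v => g (f u v)).
Proof. by move=> a x y; rewrite linearPr linearP. Qed.

Definition bpost (g : {linear W -> W'}) : {bilinear U -> V -> W'} :=
  mkBilinear (bpost_linl g) (bpost_linr g).

Lemma bpostE g u v : bpost g u v = g (f u v). Proof. by []. Qed.

End Composition.

Definition lid (K : nzRingType) (U : lmodType K) : {linear U -> U} :=
  mkLinear (linear_forE idfun).

Arguments lid {K U}.

Lemma lidE (K : nzRingType) (U : lmodType K) (x : U) : lid x = x.
Proof. by []. Qed.

Section Span.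
Variables (K : fieldType) (V : lmodType K) (P : V -> Prop).

Inductive in_span : V -> Prop :=
| span_gen v of P v : in_span v
| span_zero : in_span 0
| span_lin a u v of in_span u & in_span v : in_span (a *: u + v).

Definition span_pred : pred V := fun v => `[< in_span v >].

Lemma span_closed : submod_closed span_pred.
Proof.
split=> [|a u v /asboolP uS /asboolP vS]; apply/asboolP.
  exact: span_zero.
exact: span_lin.
Qed.

(* Membership in a MathComp subspace predicate is boolean; here it comes from
   classical logic through [asbool]. *)
Definition lspan : submodClosed V :=
  HB.pack span_pred (GRing.isSubmodClosed.Build K V span_pred span_closed).

Lemma lspanP v : v \in lspan <-> in_span v.
Proof. by split=> /asboolP. Qed.

End Span.

Section KernelImage.
Variables (K : fieldType) (U V : lmodType K) (f : {linear U -> V}).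

Definition ker_pred : pred U := fun u => f u == 0.

Lemma ker_closed : submod_closed ker_pred.
Proof.
split=> [|a u v]; rewrite !unfold_in /ker_pred ?linear0 //.
by move=> /eqP fu0 /eqP fv0; rewrite linearP fu0 fv0 scaler0 addr0.
Qed.

Definition ker : submodClosed U :=
  HB.pack ker_pred (GRing.isSubmodClosed.Build K U ker_pred ker_closed).

Lemma kerP u : u \in ker <-> f u = 0.
Proof. by split=> /eqP. Qed.

Definition im_pred : pred V := fun v => `[< exists u, f u = v >].

Lemma im_closed : submod_closed im_pred.
Proof.
split=> [|a u v /asboolP[x <-] /asboolP[y <-]]; apply/asboolP.
  by exists 0; rewrite linear0.
by exists (a *: x + y); rewrite linearP.
Qed.

Definition im : submodClosed V :=
  HB.pack im_pred (GRing.isSubmodClosed.Build K V im_pred im_closed).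

Lemma imP v : v \in im <-> exists u, f u = v.
Proof. by split=> /asboolP. Qed.

End KernelImage.

Section Subspace.
Variables (K : fieldType) (V : lmodType K) (S : submodClosed V).

Definition subspace : Type := {v : V | v \in S}.
HB.instance Definition _ := SubChoice.on subspace.
HB.instance Definition _ := [SubChoice_isSubLmodule of subspace by <:].

Definition incl : {linear subspace -> V} := mkLinear (@linearP _ _ _ _ \val).

End Subspace.

Section Corestriction.
Variables (K : fieldType) (U V W : lmodType K) (S : submodClosed W).

Section Linear.
Variables (f : {linear U -> W}) (fS : forall u, f u \in S).

Definition corestrict_fun (u : U) : subspace S := Sub (f u) (fS u).

Fact corestrict_linear : linear corestrict_fun.
Proof. by move=> a x y; apply/val_inj; rewrite [RHS]linearP /= linearP. Qed.

Definition corestrict : {linear U -> subspace S} := mkLinear corestrict_linear.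

Lemma val_corestrict u : val (corestrict u) = f u.
Proof. by []. Qed.

End Linear.

Section Bilinear.
Variables (f : {bilinear U -> V -> W}) (fS : forall u v, f u v \in S).

Definition bcorestrict_fun (u : U) (v : V) : subspace S := Sub (f u v) (fS u v).

Fact bcorestrict_linl v : linear (bcorestrict_fun^~ v).
Proof. by move=> a x y; apply/val_inj; rewrite [RHS]linearP /= linearPl. Qed.

Fact bcorestrict_linr u : linear (bcorestrict_fun u).
Proof. by move=> a x y; apply/val_inj; rewrite [RHS]linearP /= linearPr. Qed.

Definition bcorestrict : {bilinear U -> V -> subspace S} :=
  mkBilinear bcorestrict_linl bcorestrict_linr.

Lemma val_bcorestrict u v : val (bcorestrict u v) = f u v.
Proof. by []. Qed.

End Bilinear.
End Corestriction.

Section QuotientSpace.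
Variables (K : fieldType) (V : lmodType K) (S : submodClosed V).

Fact submod_opp_closed : oppr_closed S.
Proof. by move=> v vS; rewrite -scaleN1r rpredZ. Qed.

Definition quotient_zmod : zmodClosed V :=
  HB.pack (GRing.SubmodClosed.sort S)
    (GRing.isOppClosed.Build V S submod_opp_closed).

Definition quotient : Type := (Quotient.quot quotient_zmod).
HB.instance Definition _ := GRing.Zmodule.on quotient.

Definition qproj_fun (v : V) : quotient := \pi_(Quotient.quot quotient_zmod) v.
Definition qscale (a : K) (x : quotient) : quotient := qproj_fun (a *: repr x).

Fact qproj_fun_surj x : exists v, qproj_fun v = x.
Proof. by exists (repr x); rewrite /qproj_fun reprK. Qed.

Fact qproj_funP u v : qproj_fun u = qproj_fun v <-> u - v \in S.
Proof. by split=> [/eqP|uvS]; last apply/eqP; rewrite -Quotient.idealrBE. Qed.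

Fact qproj_funD u v : qproj_fun (u + v) = qproj_fun u + qproj_fun v.
Proof. by rewrite /qproj_fun !piE. Qed.

Fact qscaleE a v : qscale a (qproj_fun v) = qproj_fun (a *: v).
Proof. by apply/qproj_funP; rewrite -scalerBr rpredZ //; apply/qproj_funP; rewrite /qproj_fun reprK. Qed.

Fact qscaleA a b x : qscale a (qscale b x) = qscale (a * b) x.
Proof. by have [v <-] := qproj_fun_surj x; rewrite !qscaleE scalerA. Qed.

Fact qscale1 : left_id 1 qscale.
Proof. by move=> x; have [v <-] := qproj_fun_surj x; rewrite qscaleE scale1r. Qed.

Fact qscaleDr : right_distributive qscale +%R.
Proof.
move=> a x y; have [u <-] := qproj_fun_surj x; have [v <-] := qproj_fun_surj y.
by rewrite -qproj_funD !qscaleE scalerDr qproj_funD.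
Qed.

Fact qscaleDl x : {morph qscale^~ x : a b / a + b}.
Proof.
by move=> a b; have [v <-] := qproj_fun_surj x; rewrite !qscaleE scalerDl qproj_funD.
Qed.

HB.instance Definition _ := GRing.Zmodule_isLmodule.Build K quotient
  qscaleA qscale1 qscaleDr qscaleDl.

Fact qproj_linear : linear qproj_fun.
Proof. by move=> a u v; rewrite qproj_funD -qscaleE. Qed.

Definition qproj : {linear V -> quotient} := mkLinear qproj_linear.

Lemma qproj_surj x : exists v, qproj v = x.
Proof. exact: qproj_fun_surj. Qed.

Lemma qprojP u v : qproj u = qproj v <-> u - v \in S.
Proof. exact: qproj_funP. Qed.

Lemma qproj_eq0 v : qproj v = 0 <-> v \in S.
Proof. by rewrite -(linear0 qproj) qprojP subr0. Qed.

Section Lift.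
Variables (W : lmodType K) (f : {linear V -> W}).
Hypothesis fS : forall v, v \in S -> f v = 0.

Definition qlift_fun (x : quotient) : W := f (repr x).

Fact qlift_funE v : qlift_fun (qproj_fun v) = f v.
Proof.
by apply/eqP; rewrite -subr_eq0 -linearB fS //; apply/qproj_funP; rewrite /qproj_fun reprK.
Qed.

Fact qlift_linear : linear qlift_fun.
Proof.
move=> a x y; have [u <-] := qproj_surj x; have [v <-] := qproj_surj y.
by rewrite -linearP !qlift_funE linearP.
Qed.

Definition qlift : {linear quotient -> W} := mkLinear qlift_linear.

Lemma qliftE v : qlift (qproj v) = f v.
Proof. exact: qlift_funE. Qed.

End Lift.
End QuotientSpace.

Section FreeModule.
Variables (K : fieldType) (T : choiceType).

Definition fbasis (t : T) : {freeg T / K} := << t >>.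

Lemma fbasis_ind (P : {freeg T / K} -> Prop) :
  P 0 -> (forall a t x, P x -> P (a *: fbasis t + x)) -> forall x, P x.
Proof.
move=> P0 PS x; rewrite -(freeg_sumE x); elim: (dom x) => [|t s IHs].
  by rewrite big_nil.
rewrite big_cons; set a := coeff t x.
suff -> : << a *g t >> = a *: fbasis t by apply: PS.
by apply/eqP/freeg_eqP => k; rewrite coeffZ !coeffU mul1r.
Qed.

Variables (W : lmodType K) (f : T -> W).

Fact flift_linear : linear (fglift f).
Proof.
have fD x y : fglift f (x + y) = fglift f x + fglift f y.
  have fB := lift_is_additive f.
  have f0 : fglift f 0 = 0 by rewrite -[X in fglift f X]subr0 fB subrr.
  by rewrite -[in LHS](opprK y) fB -[- y]sub0r fB f0 sub0r opprK.
suff fZ a x : fglift f (a *: x) = a *: fglift f x by move=> a x y; rewrite fD fZ.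
elim/fbasis_ind: x => [|b t x IHx].
  by rewrite scaler0 -(freeg_nil K T) fglift_Freeg prelift_nil scaler0.
have bE c : c *: fbasis t = << c *g t >>.
  by apply/eqP/freeg_eqP => k; rewrite coeffZ !coeffU mul1r.
by rewrite scalerDr !fD IHx scalerA !bE !liftU scalerDr scalerA.
Qed.

Definition flift : {linear {freeg T / K} -> W} := mkLinear flift_linear.

Lemma fliftE t : flift (fbasis t) = f t.
Proof. by rewrite [LHS]liftU scale1r. Qed.

End FreeModule.

(* [tensor U V] is the free module on U * V modulo bilinearity. *)
Section TensorProduct.
Variables (K : fieldType) (U V : lmodType K).

Inductive bilin_rel : {freeg (U * V)%type / K} -> Prop :=
| bilin_rel_l a u u' v :
    bilin_rel (fbasis K (a *: u + u', v)
               - (a *: fbasis K (u, v) + fbasis K (u', v)))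
| bilin_rel_r a u v v' :
    bilin_rel (fbasis K (u, a *: v + v')
               - (a *: fbasis K (u, v) + fbasis K (u, v'))).

Definition tensor : lmodType K := quotient (lspan bilin_rel).

Definition tens_fun (u : U) (v : V) : tensor := qproj _ (fbasis K (u, v)).

Fact tens_linl v : linear (tens_fun^~ v).
Proof.
move=> a u u'; rewrite -linearP; apply/qprojP/lspanP/span_gen; exact: bilin_rel_l.
Qed.

Fact tens_linr u : linear (tens_fun u).
Proof.
move=> a v v'; rewrite -linearP; apply/qprojP/lspanP/span_gen; exact: bilin_rel_r.
Qed.

Definition tens : {bilinear U -> V -> tensor} := mkBilinear tens_linl tens_linr.

Lemma tensor_ind (P : tensor -> Prop) :
  P 0 -> (forall a u v t, P t -> P (a *: tens u v + t)) -> forall t, P t.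
Proof.
move=> P0 PS t; have [x <-] := qproj_surj t.
elim/fbasis_ind: x => [|a [u v] x IHx]; first by rewrite linear0.
by rewrite linearP; apply: (PS a u v).
Qed.

Lemma tensor_ext (W : lmodType K) (f g : {linear tensor -> W}) :
  (forall u v, f (tens u v) = g (tens u v)) -> f =1 g.
Proof.
move=> fg; elim/tensor_ind => [|a u v t IHt]; first by rewrite !linear0.
by rewrite !linearP fg IHt.
Qed.

Section Lift.
Variables (W : lmodType K) (f : {bilinear U -> V -> W}).

Fact tlift_subproof x :
  x \in lspan bilin_rel -> flift (fun p : U * V => f p.1 p.2) x = 0.
Proof.
move=> /lspanP; elim=> [y||a y z _ y0 _ z0]; last 2 first.
- by rewrite linear0.
- by rewrite linearP y0 z0 scaler0 addr0.
case=> [a u u' v|a u v v'];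
  by rewrite linearB linearP !fliftE /= ?linearPl ?linearPr subrr.
Qed.

Definition tlift : {linear tensor -> W} := qlift tlift_subproof.

Lemma tliftE u v : tlift (tens u v) = f u v.
Proof. by rewrite /tlift qliftE fliftE. Qed.

End Lift.
End TensorProduct.

Lemma tensor3_ext (K : fieldType) (U V W X : lmodType K)
    (f g : {linear tensor (tensor U V) W -> X}) :
  (forall u v w, f (tens _ _ (tens _ _ u v) w) = g (tens _ _ (tens _ _ u v) w)) ->
  f =1 g.
Proof.
move=> fg; apply: tensor_ext => t w; elim/tensor_ind: t => [|a u v t IHt].
  by rewrite !linear0l !linear0.
by rewrite !linearPl !linearP fg IHt.
Qed.

Definition tensor_map (K : fieldType) (U V U' V' : lmodType K)
    (f : {linear U -> U'}) (g : {linear V -> V'}) :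
    {linear tensor U V -> tensor U' V'} :=
  tlift (bcomp (tens U' V') f g).

Lemma tensor_mapE (K : fieldType) (U V U' V' : lmodType K)
    (f : {linear U -> U'}) (g : {linear V -> V'}) u v :
  tensor_map f g (tens U V u v) = tens U' V' (f u) (g v).
Proof. exact: tliftE. Qed.

Section LinearCombinators.
Variables (K : fieldType) (U V : lmodType K).

Lemma linear_add (f g : U -> V) :
  linear f -> linear g -> linear (fun x => f x + g x).
Proof. by move=> fl gl a x y; rewrite fl gl scalerDr addrACA. Qed.

Lemma linear_sub (f g : U -> V) :
  linear f -> linear g -> linear (fun x => f x - g x).
Proof. by move=> fl gl a x y; rewrite fl gl scalerBr opprD addrACA. Qed.

End LinearCombinators.

Lemma pair_linl (K : nzRingType) (U V : lmodType K) a (u u' : U) :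
  (a *: u + u', 0 : V) = a *: (u, 0) + (u', 0).
Proof. by apply: injective_projections => //=; rewrite scaler0 addr0. Qed.

Lemma pair_linr (K : nzRingType) (U V : lmodType K) a (v v' : V) :
  (0 : U, a *: v + v') = a *: (0, v) + (0, v').
Proof. by apply: injective_projections => //=; rewrite scaler0 addr0. Qed.

Definition exact (K : fieldType) (U V W : lmodType K)
    (f : {linear U -> V}) (g : {linear V -> W}) :=
  forall v, g v = 0 <-> exists u, f u = v.

Record homLeibniz (K : fieldType) := HomLeibniz {
  hl_space :> lmodType K;
  hl_br : {bilinear hl_space -> hl_space -> hl_space};
  hl_twist : {linear hl_space -> hl_space};
  hl_leibniz x y z :
    hl_br (hl_twist x) (hl_br y z) =
      hl_br (hl_br x y) (hl_twist z) - hl_br (hl_br x z) (hl_twist y);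
  hl_twist_br x y : hl_twist (hl_br x y) = hl_br (hl_twist x) (hl_twist y)
}.

(* Mutual actions of L and M are given by [action L M] and [action M L].  Only
   the bilinear operations x, m |-> ^x m ([lact]) and m, x |-> m^x ([ract]) are
   recorded: no axiom on them enters the definition of M * N below. *)
Record action (K : fieldType) (L M : homLeibniz K) := Action {
  lact : {bilinear L -> M -> M};
  ract : {bilinear M -> L -> M}
}.

(* The two kinds of generators m * n and n * m of the non-abelian tensor product
   [star] of M and N are the pure tensors in the two summands of
   (M (x) N) (+) (N (x) M).  In [star_rel] a relation u = v is encoded as the
   element u - v; [la], [ra], [lc], [rc] stand for ^m n, n^m, ^n m and m^n. *)
Section NonAbelianTensor.
Variables (K : fieldType) (M N : homLeibniz K).
Variables (aMN : action M N) (aNM : action N M).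

Local Notation "m ** n" := (tens M N m n, 0 : tensor N M) (at level 40).
Local Notation "n ^** m" := (0 : tensor M N, tens N M n m) (at level 40).
Local Notation al := (hl_twist _).
Local Notation br := (hl_br _).
Local Notation la := (lact aMN).
Local Notation ra := (ract aMN).
Local Notation lc := (lact aNM).
Local Notation rc := (ract aNM).

Inductive star_rel : (tensor M N * tensor N M)%type -> Prop :=
| star_rel1 m n n' : star_rel
    (al m ** br n n' - (rc m n ** al n' - rc m n' ** al n))
| star_rel2 n m m' : star_rel
    (al n ^** br m m' - (ra n m ^** al m' - ra n m' ^** al m))
| star_rel3 m m' n : star_rel
    (br m m' ** al n - (la m n ^** al m' - al m ** ra n m'))
| star_rel4 n n' m : star_rel
    (br n n' ^** al m - (lc n m ** al n' - al n ^** rc m n'))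
| star_rel5 m m' n : star_rel
    (al m ** la m' n - - (al m ** ra n m'))
| star_rel6 n n' m : star_rel
    (al n ^** lc n' m - - (al n ^** rc m n'))
| star_rel7 m m' n n' : star_rel
    (rc m n ** la m' n' - la m n ^** rc m' n')
| star_rel8 m m' n n' : star_rel
    (rc m n ** ra n' m' - la m n ^** lc n' m')
| star_rel9 m m' n n' : star_rel
    (lc n m ** la m' n' - ra n m ^** rc m' n')
| star_rel10 m m' n n' : star_rel
    (lc n m ** ra n' m' - ra n m ^** lc n' m').

Definition star : lmodType K := quotient (lspan star_rel).

Definition starl (m : M) (n : N) : star := qproj _ (m ** n).
Definition starr (n : N) (m : M) : star := qproj _ (n ^** m).

Section Lift.
Variables (W : lmodType K).
Variables (f : {bilinear M -> N -> W}) (g : {bilinear N -> M -> W}).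

Definition star_pre_fun (p : tensor M N * tensor N M) : W := tlift f p.1 + tlift g p.2.

Fact star_pre_linear : linear star_pre_fun.
Proof.
by move=> a p q; rewrite /star_pre_fun !linearP scalerDr addrACA.
Qed.

Definition star_pre := mkLinear star_pre_linear.

Lemma star_pre_l m n : star_pre (m ** n) = f m n.
Proof. by rewrite mkLinearE /star_pre_fun tliftE linear0 addr0. Qed.

Lemma star_pre_r n m : star_pre (n ^** m) = g n m.
Proof. by rewrite mkLinearE /star_pre_fun tliftE linear0 add0r. Qed.

(* A pair (f, g) induces a linear map on [star] with m * n |-> f m n and
   n * m |-> g n m provided that it respects the ten relations. *)
Record star_compatible : Prop := StarCompatible {
  star_compat1 m n n' :
    f (al m) (br n n') = f (rc m n) (al n') - f (rc m n') (al n);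
  star_compat2 n m m' :
    g (al n) (br m m') = g (ra n m) (al m') - g (ra n m') (al m);
  star_compat3 m m' n :
    f (br m m') (al n) = g (la m n) (al m') - f (al m) (ra n m');
  star_compat4 n n' m :
    g (br n n') (al m) = f (lc n m) (al n') - g (al n) (rc m n');
  star_compat5 m m' n :
    f (al m) (la m' n) = - (f (al m) (ra n m'));
  star_compat6 n n' m :
    g (al n) (lc n' m) = - (g (al n) (rc m n'));
  star_compat7 m m' n n' :
    f (rc m n) (la m' n') = g (la m n) (rc m' n');
  star_compat8 m m' n n' :
    f (rc m n) (ra n' m') = g (la m n) (lc n' m');
  star_compat9 m m' n n' :
    f (lc n m) (la m' n') = g (ra n m) (rc m' n');
  star_compat10 m m' n n' :
    f (lc n m) (ra n' m') = g (ra n m) (lc n' m')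
}.

Hypothesis fg : star_compatible.

Fact star_pre_rel p : star_rel p -> star_pre p = 0.
Proof.
case=> *; apply/eqP; rewrite linearB subr_eq0 ?linearB ?linearN
  !(star_pre_l, star_pre_r); apply/eqP.
- exact: star_compat1.
- exact: star_compat2.
- exact: star_compat3.
- exact: star_compat4.
- exact: star_compat5.
- exact: star_compat6.
- exact: star_compat7.
- exact: star_compat8.
- exact: star_compat9.
- exact: star_compat10.
Qed.

Fact star_lift_subproof p : p \in lspan star_rel -> star_pre p = 0.
Proof.
move=> /lspanP; elim=> [q /star_pre_rel//||a q r _ q0 _ r0].
  by rewrite linear0.
by rewrite linearP q0 r0 scaler0 addr0.
Qed.

Definition star_lift : {linear star -> W} := qlift star_lift_subproof.

Lemma star_lift_l m n : star_lift (starl m n) = f m n.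
Proof. by rewrite /star_lift qliftE star_pre_l. Qed.

Lemma star_lift_r n m : star_lift (starr n m) = g n m.
Proof. by rewrite /star_lift qliftE star_pre_r. Qed.

End Lift.

Fact starl_linl n : linear (starl^~ n).
Proof. by move=> a m m'; rewrite /starl linearPl pair_linl linearP. Qed.

Fact starl_linr m : linear (starl m).
Proof. by move=> a n n'; rewrite /starl linearPr pair_linl linearP. Qed.

Fact starr_linl m : linear (starr^~ m).
Proof. by move=> a n n'; rewrite /starr linearPl pair_linr linearP. Qed.

Fact starr_linr n : linear (starr n).
Proof. by move=> a m m'; rewrite /starr linearPr pair_linr linearP. Qed.

Lemma star_eq1 m n n' :
  starl (al m) (br n n') = starl (rc m n) (al n') - starl (rc m n') (al n).
Proof. by rewrite -linearB; apply/qprojP/lspanP/span_gen; exact: star_rel1. Qed.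

Lemma star_eq2 n m m' :
  starr (al n) (br m m') = starr (ra n m) (al m') - starr (ra n m') (al m).
Proof. by rewrite -linearB; apply/qprojP/lspanP/span_gen; exact: star_rel2. Qed.

Lemma star_eq3 m m' n :
  starl (br m m') (al n) = starr (la m n) (al m') - starl (al m) (ra n m').
Proof. by rewrite -linearB; apply/qprojP/lspanP/span_gen; exact: star_rel3. Qed.

Lemma star_eq4 n n' m :
  starr (br n n') (al m) = starl (lc n m) (al n') - starr (al n) (rc m n').
Proof. by rewrite -linearB; apply/qprojP/lspanP/span_gen; exact: star_rel4. Qed.

Lemma star_eq5 m m' n :
  starl (al m) (la m' n) = - (starl (al m) (ra n m')).
Proof. by rewrite -linearN; apply/qprojP/lspanP/span_gen; exact: star_rel5. Qed.

Lemma star_eq6 n n' m :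
  starr (al n) (lc n' m) = - (starr (al n) (rc m n')).
Proof. by rewrite -linearN; apply/qprojP/lspanP/span_gen; exact: star_rel6. Qed.

Lemma star_eq7 m m' n n' :
  starl (rc m n) (la m' n') = starr (la m n) (rc m' n').
Proof. by apply/qprojP/lspanP/span_gen; exact: star_rel7. Qed.

Lemma star_eq8 m m' n n' :
  starl (rc m n) (ra n' m') = starr (la m n) (lc n' m').
Proof. by apply/qprojP/lspanP/span_gen; exact: star_rel8. Qed.

Lemma star_eq9 m m' n n' :
  starl (lc n m) (la m' n') = starr (ra n m) (rc m' n').
Proof. by apply/qprojP/lspanP/span_gen; exact: star_rel9. Qed.

Lemma star_eq10 m m' n n' :
  starl (lc n m) (ra n' m') = starr (ra n m) (lc n' m').
Proof. by apply/qprojP/lspanP/span_gen; exact: star_rel10. Qed.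

End NonAbelianTensor.

Section StarMap.
Variables (K : fieldType) (M N N' : homLeibniz K).
Variables (aMN : action M N) (aNM : action N M).
Variables (aMN' : action M N') (aNM' : action N' M).

(* Conditions under which a linear map N -> N' induces M * N -> M * N'. *)
Record equivariant (g : {linear N -> N'}) : Prop := Equivariant {
  eqv_br n1 n2 : g (hl_br N n1 n2) = hl_br N' (g n1) (g n2);
  eqv_twist n : g (hl_twist N n) = hl_twist N' (g n);
  eqv_lact m n : g (lact aMN m n) = lact aMN' m (g n);
  eqv_ract n m : g (ract aMN n m) = ract aMN' (g n) m;
  eqv_coact_l n m : lact aNM n m = lact aNM' (g n) m;
  eqv_coact_r m n : ract aNM m n = ract aNM' m (g n)
}.

Variables (g : {linear N -> N'}) (g_eqv : equivariant g).

Definition star_map_fl (m : M) (n : N) := starl aMN' aNM' m (g n).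
Definition star_map_fr (n : N) (m : M) := starr aMN' aNM' (g n) m.

Fact star_map_ll n : linear (star_map_fl^~ n). Proof. exact: starl_linl. Qed.
Fact star_map_lr m : linear (star_map_fl m).
Proof. by move=> a n n'; rewrite /star_map_fl linearP starl_linr. Qed.
Fact star_map_rl m : linear (star_map_fr^~ m).
Proof. by move=> a n n'; rewrite /star_map_fr linearP starr_linl. Qed.
Fact star_map_rr n : linear (star_map_fr n). Proof. exact: starr_linr. Qed.

Fact star_map_subproof : star_compatible aMN aNM
  (mkBilinear star_map_ll star_map_lr) (mkBilinear star_map_rl star_map_rr).
Proof.
case: g_eqv => g_br g_al g_la g_ra g_lc g_rc.
split=> *; rewrite !mkBilinearE /star_map_fl /star_map_fr ?g_br ?g_al ?g_la ?g_ra ?g_lc ?g_rc.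
- exact: star_eq1.
- exact: star_eq2.
- exact: star_eq3.
- exact: star_eq4.
- exact: star_eq5.
- exact: star_eq6.
- exact: star_eq7.
- exact: star_eq8.
- exact: star_eq9.
- exact: star_eq10.
Qed.

Definition star_map : {linear star aMN aNM -> star aMN' aNM'} :=
  star_lift star_map_subproof.

Lemma star_map_l m n : star_map (starl aMN aNM m n) = starl aMN' aNM' m (g n).
Proof. exact: star_lift_l. Qed.

Lemma star_map_r n m : star_map (starr aMN aNM n m) = starr aMN' aNM' (g n) m.
Proof. exact: star_lift_r. Qed.

End StarMap.

Record homAssoc (K : fieldType) := HomAssoc {
  ha_space :> lmodType K;
  ha_mul : {bilinear ha_space -> ha_space -> ha_space};
  ha_twist : {linear ha_space -> ha_space};
  ha_assoc a b c :
    ha_mul (ha_twist a) (ha_mul b c) = ha_mul (ha_mul a b) (ha_twist c);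
  ha_twist_mul a b : ha_twist (ha_mul a b) = ha_mul (ha_twist a) (ha_twist b)
}.

Section HomAssociative.
Variables (K : fieldType) (A : homAssoc K).

Local Notation mul := (ha_mul A).
Local Notation al := (ha_twist A).

Definition comm_fun (a b : A) : A := mul a b - mul b a.

Fact comm_linl b : linear (comm_fun^~ b).
Proof. by apply: linear_sub => k a a'; rewrite ?linearPl ?linearPr. Qed.

Fact comm_linr a : linear (comm_fun a).
Proof. by apply: linear_sub => k b b'; rewrite ?linearPl ?linearPr. Qed.

Definition comm : {bilinear A -> A -> A} := mkBilinear comm_linl comm_linr.

Lemma commE a b : comm a b = mul a b - mul b a.
Proof. by []. Qed.

Lemma commC a b : comm a b = - comm b a.
Proof. by rewrite !commE opprB. Qed.

Definition alpha_identity :=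
  forall a b : A, (exists c, b = al c - c) -> mul a b - mul b a = 0.

Lemma alpha_identity_r a b : alpha_identity -> comm a (al b) = comm a b.
Proof.
move=> h; apply/eqP; rewrite -subr_eq0 -linearBr commE; apply/eqP/h.
by exists b.
Qed.

Lemma alpha_identity_l a b : alpha_identity -> comm (al a) b = comm a b.
Proof. by move=> h; rewrite commC alpha_identity_r // -commC. Qed.

Fact comm_leibniz x y z :
  comm (al x) (comm y z) = comm (comm x y) (al z) - comm (comm x z) (al y).
Proof.
rewrite !commE !(linearBl, linearBr) !ha_assoc !opprB.
by rewrite [RHS](AC ((2*2)*(2*2)) (((1*8)*(3*6))*((5*2)*(7*4)))) /= !subrr !addr0.
Qed.

Fact twist_comm x y : al (comm x y) = comm (al x) (al y).
Proof. by rewrite !commE linearB !ha_twist_mul. Qed.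

Definition leibniz_of : homLeibniz K := HomLeibniz comm_leibniz twist_comm.

Definition comm_span : submodClosed A :=
  lspan (fun x : A => exists a b, x = comm a b).

Lemma comm_in a b : comm a b \in comm_span.
Proof. by apply/lspanP/span_gen; exists a, b. Qed.

Lemma twist_comm_in x : x \in comm_span -> al x \in comm_span.
Proof.
move=> /lspanP; elim=> [_ [a [b ->]]||k y z _ yS _ zS].
- by rewrite twist_comm comm_in.
- by rewrite linear0 rpred0.
- by rewrite linearP rpredD ?rpredZ.
Qed.

Definition commutator_twist : {linear subspace comm_span -> subspace comm_span} :=
  @corestrict _ _ _ comm_span (lcomp al (incl comm_span))
    (fun x => twist_comm_in (valP x)).

Definition commutator_br :=
  @bcorestrict _ _ _ _ comm_span (bcomp comm (incl comm_span) (incl comm_span))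
    (fun x y => comm_in (val x) (val y)).

Fact commutator_leibniz x y z :
  commutator_br (commutator_twist x) (commutator_br y z) =
    commutator_br (commutator_br x y) (commutator_twist z)
    - commutator_br (commutator_br x z) (commutator_twist y).
Proof. by apply/val_inj; rewrite linearB; apply: comm_leibniz. Qed.

Fact commutator_twist_br x y :
  commutator_twist (commutator_br x y) =
    commutator_br (commutator_twist x) (commutator_twist y).
Proof. by apply/val_inj; apply: twist_comm. Qed.

Definition commutator_alg : homLeibniz K :=
  HomLeibniz commutator_leibniz commutator_twist_br.

Definition act_A_AA : action leibniz_of commutator_alg := {|
  lact := @bcorestrict _ leibniz_of commutator_alg _ comm_span
    (bcomp comm lid (incl comm_span)) (fun a x => comm_in a (val x));
  ract := @bcorestrict _ commutator_alg leibniz_of _ comm_span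
    (bcomp comm (incl comm_span) lid) (fun x a => comm_in (val x) a)
|}.

Definition act_AA_A : action commutator_alg leibniz_of := {|
  lact := bcomp comm (incl comm_span) lid :
    {bilinear commutator_alg -> leibniz_of -> leibniz_of};
  ract := bcomp comm lid (incl comm_span) :
    {bilinear leibniz_of -> commutator_alg -> leibniz_of}
|}.

(* [A, [A, A]], as a subspace of [A, A]. *)
Definition A_AA_span : submodClosed commutator_alg :=
  lspan (fun y : commutator_alg =>
           exists (a : A) (x : commutator_alg), val y = comm a (val x)).

Local Notation AoA := (tensor A A).
Local Notation "a ** b" := (tens A A a b) (at level 40).

Section B3.
Variable c : A.

Definition b3_fun (a b : A) : AoA := mul a b ** al c - al a ** mul b c + mul c a ** al b.

Fact b3_linl b : linear (b3_fun^~ b).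
Proof.
apply: linear_add; first apply: linear_sub;
  by move=> k x y; rewrite ?(linearP, linearPl, linearPr).
Qed.

Fact b3_linr a : linear (b3_fun a).
Proof.
apply: linear_add; first apply: linear_sub;
  by move=> k x y; rewrite !(linearP, linearPl, linearPr).
Qed.

Definition b3_at := mkBilinear b3_linl b3_linr.

End B3.

Definition b3_fun3 (t : AoA) (c : A) : AoA := tlift (b3_at c) t.

Fact b3_linear_l c : linear (b3_fun3^~ c).
Proof. exact: linear_forE. Qed.

Fact b3_linear_r t : linear (b3_fun3 t).
Proof.
move=> k c d; elim/tensor_ind: t => [|h a b t IHt].
  by rewrite /b3_fun3 !linear0 addr0.
rewrite /b3_fun3 in IHt *.
have E : b3_at (k *: c + d) a b = k *: b3_at c a b + b3_at d a b.
  rewrite !mkBilinearE.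
  suff L : linear (fun x => mul a b ** al x - al a ** mul b x + mul x a ** al b).
    exact: L.
  apply: linear_add; first apply: linear_sub;
    by move=> e x y; rewrite !(linearP, linearPl, linearPr).
rewrite ![tlift _ (_ *: _ + _)]linearP IHt !tliftE E.
by rewrite !scalerDr !scalerA (mulrC k) addrACA.
Qed.

Definition b3 : {linear tensor AoA A -> AoA} :=
  tlift (mkBilinear b3_linear_l b3_linear_r).

Lemma b3E a b c :
  b3 (tens AoA A (a ** b) c) =
    mul a b ** al c - al a ** mul b c + mul c a ** al b.
Proof. by rewrite /b3 tliftE mkBilinearE /b3_fun3 tliftE. Qed.

(* L_alpha(A), with [box a b] the class of a (x) b. *)
Definition L_space : lmodType K := quotient (im b3).

Definition L_class : {linear AoA -> L_space} := qproj (im b3).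

Definition box : {bilinear A -> A -> L_space} := bpost (tens A A) L_class.

Lemma boxE a b : box a b = L_class (a ** b).
Proof. by []. Qed.

Lemma box_ext (W : lmodType K) (f g : {linear L_space -> W}) :
  (forall a b, f (box a b) = g (box a b)) -> f =1 g.
Proof.
move=> fg x; have [t <-] := qproj_surj x.
exact: (@tensor_ext _ _ _ _ (lcomp f (qproj _)) (lcomp g (qproj _))).
Qed.

Lemma box_b3 a b c :
  box (mul a b) (al c) - box (al a) (mul b c) + box (mul c a) (al b) = 0.
Proof.
rewrite !boxE -linearB -linearD; apply/qproj_eq0/imP.
by exists (tens AoA A (a ** b) c); rewrite b3E.
Qed.

Lemma box_comm a b c :
  box (al a) (comm b c) = box (comm a b) (al c) - box (comm a c) (al b).
Proof.
have E x y z : box (al x) (mul y z) = box (mul x y) (al z) + box (mul z x) (al y).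
  by apply/eqP; rewrite eq_sym -subr_eq0 addrAC box_b3.
rewrite !commE linearBr !linearBl !E opprB !opprD !addrA.
by rewrite [LHS](ACl (1*4*3*2)) [RHS](ACl (1*2*4*3)).
Qed.

Section LLift.
Variables (W : lmodType K) (f : {bilinear A -> A -> W}).
Hypothesis f_b3 : forall a b c,
  f (mul a b) (al c) - f (al a) (mul b c) + f (mul c a) (al b) = 0.

Fact Llift_subproof t : t \in im b3 -> tlift f t = 0.
Proof.
move=> /imP[{}t <-].
apply: (@tensor3_ext _ _ _ _ _ (lcomp (tlift f) b3) (lcomp \0 b3)) => a b c.
by rewrite !lcompE b3E linearD linearB !tliftE f_b3.
Qed.

Definition Llift : {linear L_space -> W} := qlift Llift_subproof.

Lemma LliftE a b : Llift (box a b) = f a b.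
Proof. by rewrite /Llift boxE qliftE tliftE. Qed.

End LLift.

Fact comm_b3 a b c :
  comm (mul a b) (al c) - comm (al a) (mul b c) + comm (mul c a) (al b) = 0.
Proof.
rewrite !commE !ha_assoc !opprB !addrA.
by rewrite [LHS](ACl ((1*4)*(2*5)*(3*6))) /= ?(subrr, addNr) ?addr0 ?add0r.
Qed.

Fact box_twist_b3 a b c : bcomp box al al (mul a b) (al c)
  - bcomp box al al (al a) (mul b c) + bcomp box al al (mul c a) (al b) = 0.
Proof. by rewrite !bcompE !ha_twist_mul box_b3. Qed.

Definition L_twist : {linear L_space -> L_space} := Llift box_twist_b3.

Lemma L_twistE a b : L_twist (box a b) = box (al a) (al b).
Proof. exact: LliftE. Qed.

Definition phiA : {linear L_space -> A} := Llift comm_b3.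

Lemma phiAE a b : phiA (box a b) = comm a b.
Proof. exact: LliftE. Qed.

Fact phiA_in x : phiA x \in comm_span.
Proof.
have [t <-] := qproj_surj x; elim/tensor_ind: t => [|k a b t IHt].
  by rewrite !linear0 rpred0.
by rewrite !linearP rpredD ?rpredZ // -boxE phiAE comm_in.
Qed.

Definition phi : {linear L_space -> commutator_alg} :=
  @corestrict _ _ _ comm_span phiA phiA_in.

Lemma val_phi x : val (phi x) = phiA x. Proof. by []. Qed.

Lemma phi_twistA x : phiA (L_twist x) = al (phiA x).
Proof.
apply: (@box_ext _ (lcomp phiA L_twist) (lcomp al phiA)) => a b.
by rewrite !lcompE L_twistE !phiAE twist_comm.
Qed.

(* Since [phiA] extends [box a b] |-> [a, b], the bracket of [box a b] and
   [box a' b'] is [box [a, b] [a', b']], see [L_brE]. *)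
Definition L_br : {bilinear L_space -> L_space -> L_space} := bcomp box phiA phiA.

Lemma L_brE a b a' b' :
  L_br (box a b) (box a' b') = box (comm a b) (comm a' b').
Proof. by rewrite bcompE !phiAE. Qed.

Fact L_leibniz x y z :
  L_br (L_twist x) (L_br y z) =
    L_br (L_br x y) (L_twist z) - L_br (L_br x z) (L_twist y).
Proof. by rewrite !bcompE !phi_twistA !phiAE box_comm. Qed.

Fact L_twist_br x y : L_twist (L_br x y) = L_br (L_twist x) (L_twist y).
Proof. by rewrite !bcompE L_twistE !phi_twistA. Qed.

Definition L_alg : homLeibniz K := HomLeibniz L_leibniz L_twist_br.

(* The actions of A on L_alpha(A) are defined on the classes [box a b] by the
   formulas [lact_box] and [ract_box] below. *)
Section ActionsOnL.
Variable c : A.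

Definition L_lact_gen (a b : A) : L_space := box (comm c a) (al b) - box (comm c b) (al a).

Fact l_linl b : linear (L_lact_gen^~ b).
Proof.
by apply: linear_sub => k x y; rewrite ?linearPr ?linearP ?linearPl ?linearPr.
Qed.

Fact l_linr a : linear (L_lact_gen a).
Proof.
by apply: linear_sub => k x y; rewrite ?linearPr ?linearP ?linearPl ?linearPr.
Qed.

Definition L_lact_at := mkBilinear l_linl l_linr.

Lemma L_lact_atE a b : L_lact_at a b = box (al c) (comm a b).
Proof. by rewrite box_comm. Qed.

Fact L_lact_b3 x y z :
  L_lact_at (mul x y) (al z) - L_lact_at (al x) (mul y z)
  + L_lact_at (mul z x) (al y) = 0.
Proof. by rewrite !L_lact_atE -linearBr -linearDr comm_b3 linear0r. Qed.

Definition L_ract_gen (a b : A) : L_space := box (comm a c) (al b) + box (al a) (comm b c).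

Fact r_linl b : linear (L_ract_gen^~ b).
Proof. by apply: linear_add => k x y; rewrite ?linearP ?linearPl ?linearPl. Qed.

Fact r_linr a : linear (L_ract_gen a).
Proof. by apply: linear_add => k x y; rewrite ?linearPl ?linearP ?linearPr. Qed.

Definition L_ract_at := mkBilinear r_linl r_linr.

Lemma L_ract_atE a b : L_ract_at a b = box (comm a b) (al c).
Proof. by rewrite mkBilinearE /L_ract_gen box_comm addrC subrK. Qed.

Fact L_ract_b3 x y z :
  L_ract_at (mul x y) (al z) - L_ract_at (al x) (mul y z)
  + L_ract_at (mul z x) (al y) = 0.
Proof. by rewrite !L_ract_atE -linearBl -linearDl comm_b3 linear0l. Qed.

End ActionsOnL.

Definition L_lact_fun (c : A) (x : L_space) : L_space := Llift (L_lact_b3 c) x.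
Definition L_ract_fun (x : L_space) (c : A) : L_space := Llift (L_ract_b3 c) x.

Fact L_lact_funE c x : L_lact_fun c x = box (al c) (phiA x).
Proof.
apply: (@box_ext _ _ (lcomp (mkLinear (linear_forE (box (al c)))) phiA)) => a b.
apply: etrans (LliftE _ _ _) (etrans (L_lact_atE _ _ _) _).
exact: (congr1 (box (al c)) (esym (phiAE a b))).
Qed.

Fact L_ract_funE x c : L_ract_fun x c = box (phiA x) (al c).
Proof.
apply: (@box_ext _ _ (lcomp (mkLinear (linearPl box (al c))) phiA)) => a b.
apply: etrans (LliftE _ _ _) (etrans (L_ract_atE _ _ _) _).
exact: (congr1 (box^~ (al c)) (esym (phiAE a b))).
Qed.

Fact L_lact_linl x : linear (L_lact_fun^~ x).
Proof. by move=> k c d; rewrite !L_lact_funE linearP linearPl. Qed.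

Fact L_lact_linr c : linear (L_lact_fun c). Proof. exact: linear_forE. Qed.

Fact L_ract_linl c : linear (L_ract_fun^~ c). Proof. exact: linear_forE. Qed.

Fact L_ract_linr x : linear (L_ract_fun x).
Proof. by move=> k c d; rewrite !L_ract_funE linearP linearPr. Qed.

Definition act_A_L : action leibniz_of L_alg :=
  @Action K leibniz_of L_alg (mkBilinear L_lact_linl L_lact_linr)
                     (mkBilinear L_ract_linl L_ract_linr).

Lemma lact_box c a b :
  lact act_A_L c (box a b) = box (comm c a) (al b) - box (comm c b) (al a).
Proof. exact: (LliftE (L_lact_b3 c) a b). Qed.

Lemma ract_box c a b :
  ract act_A_L (box a b) c = box (comm a c) (al b) + box (al a) (comm b c).
Proof. exact: (LliftE (L_ract_b3 c) a b). Qed.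

Lemma lact_LE c x : lact act_A_L c x = box (al c) (phiA x).
Proof. exact: L_lact_funE. Qed.

Lemma ract_LE x c : ract act_A_L x c = box (phiA x) (al c).
Proof. exact: L_ract_funE. Qed.

(* On the classes [box a b] this is [lact_L_AE] and [ract_L_AE]. *)
Definition act_L_A : action L_alg leibniz_of :=
  @Action K L_alg leibniz_of (bcomp comm phiA lid) (bcomp comm lid phiA).

Lemma lact_L_AE a b c : lact act_L_A (box a b) c = comm (comm a b) c.
Proof. exact: (congr1 (comm^~ c) (phiAE a b)). Qed.

Lemma ract_L_AE a b c : ract act_L_A c (box a b) = comm c (comm a b).
Proof. exact: (congr1 (comm c) (phiAE a b)). Qed.

Definition HH_incl : {linear subspace (ker phi) -> L_space} := incl (ker phi).

Lemma phi_HH h : phiA (HH_incl h) = 0.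
Proof. by rewrite -val_phi; have /kerP -> := valP h. Qed.

Lemma phiA_ker x : phiA x = 0 -> x \in ker phi.
Proof. by move=> x0; apply/kerP/val_inj. Qed.

Fact HH_twist_in h : lcomp L_twist HH_incl h \in ker phi.
Proof. by apply: phiA_ker; rewrite lcompE phi_twistA phi_HH linear0. Qed.

Definition HH_twist := corestrict HH_twist_in.

Fact zero_linear (U V : lmodType K) : linear (fun _ : U => 0 : V).
Proof. by move=> a x y; rewrite scaler0 addr0. Qed.

Definition HH_br : {bilinear subspace (ker phi) -> subspace (ker phi) ->
    subspace (ker phi)} :=
  mkBilinear (fun _ => @zero_linear _ _) (fun _ => @zero_linear _ _).

Fact HH_leibniz x y z :
  HH_br (HH_twist x) (HH_br y z) =
    HH_br (HH_br x y) (HH_twist z) - HH_br (HH_br x z) (HH_twist y).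
Proof. by rewrite !mkBilinearE subrr. Qed.

Fact HH_twist_br x y : HH_twist (HH_br x y) = HH_br (HH_twist x) (HH_twist y).
Proof. by rewrite !mkBilinearE linear0. Qed.

Definition HH1 : homLeibniz K := HomLeibniz HH_leibniz HH_twist_br.

Fact HH_lact_in (a : leibniz_of) (h : HH1) :
  bcomp (lact act_A_L) lid HH_incl a h \in ker phi.
Proof. by rewrite bcompE lact_LE phi_HH linear0r rpred0. Qed.

Fact HH_ract_in (h : HH1) (a : leibniz_of) :
  bcomp (ract act_A_L) HH_incl lid h a \in ker phi.
Proof. by rewrite bcompE ract_LE phi_HH linear0l rpred0. Qed.

Definition act_A_HH : action leibniz_of HH1 :=
  @Action K leibniz_of HH1 (bcorestrict HH_lact_in) (bcorestrict HH_ract_in).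

Definition act_HH_A : action HH1 leibniz_of :=
  @Action K HH1 leibniz_of (bcomp (lact act_L_A) HH_incl lid)
                    (bcomp (ract act_L_A) lid HH_incl).

Inductive milnor_rel : AoA -> Prop :=
| milnor_rel1 a b c :
    milnor_rel (mul a b ** al c - al a ** mul b c + mul c a ** al b)
| milnor_rel2 a b c : milnor_rel (al a ** mul b c - al a ** mul c b)
| milnor_rel3 a b c : milnor_rel (mul a b ** al c - mul b a ** al c).

Definition HH1_Milnor : lmodType K := quotient (lspan milnor_rel).

Definition milnor_class : {linear AoA -> HH1_Milnor} := qproj (lspan milnor_rel).

Definition star_A_HH : lmodType K := star act_A_HH act_HH_A.
Definition star_A_L : lmodType K := star act_A_L act_L_A.
Definition star_A_AA : lmodType K := star act_A_AA act_AA_A.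

Lemma comm_leibniz3 x y z :
  comm (comm x y) (al z) = comm (comm x z) (al y) - comm (al x) (comm z y).
Proof. by rewrite comm_leibniz opprB addrC subrK. Qed.

Lemma box_comm3 x y z :
  box (comm x y) (al z) = box (comm x z) (al y) - box (al x) (comm z y).
Proof. by rewrite box_comm opprB addrC subrK. Qed.

(* [ev_AA] and [ev_L] are the maps A * N -> N, a * n |-> ^a n, n * a |-> n^a, for
   N = [A, A] and N = L_alpha(A).  The alpha-identity condition is what makes the
   second one well defined. *)
Fact ev_AA_compatible : star_compatible act_A_AA act_AA_A
  (lact act_A_AA) (ract act_A_AA).
Proof.
have comm_flip (a b c : A) : comm a (comm b c) = - comm a (comm c b).
  by rewrite -linearNr -commC.
split=> *; apply/val_inj.
- exact: comm_leibniz.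
- exact: comm_leibniz.
- exact: comm_leibniz3.
- exact: comm_leibniz3.
- exact: comm_flip.
- exact: comm_flip.
- by [].
- by [].
- by [].
- by [].
Qed.

Definition ev_AA : {linear star_A_AA -> commutator_alg} := star_lift ev_AA_compatible.

Lemma ev_AA_l a x : ev_AA (starl _ _ a x) = lact act_A_AA a x.
Proof. exact: (star_lift_l ev_AA_compatible). Qed.

Lemma ev_AA_r x a : ev_AA (starr _ _ x a) = ract act_A_AA x a.
Proof. exact: (star_lift_r ev_AA_compatible). Qed.

Section AlphaIdentity.
Hypothesis hA : alpha_identity.

Fact phiA_lact a x : phiA (lact act_A_L a x) = comm a (phiA x).
Proof. by rewrite lact_LE phiAE alpha_identity_l. Qed.

Fact phiA_ract x a : phiA (ract act_A_L x a) = comm (phiA x) a.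
Proof. by rewrite ract_LE phiAE alpha_identity_r. Qed.

Fact ev_L_compatible : star_compatible act_A_L act_L_A
  (lact act_A_L) (ract act_A_L).
Proof.
have al_comm a b : al (comm a b) = comm a b.
  by rewrite twist_comm alpha_identity_l // alpha_identity_r.
have brE x y : phiA (hl_br L_alg x y) = comm (phiA x) (phiA y) by exact: phiAE.
have alE x : phiA (hl_twist L_alg x) = al (phiA x) by exact: phi_twistA.
have lcE x a : lact act_L_A x a = comm (phiA x) a by [].
have rcE a x : ract act_L_A a x = comm a (phiA x) by [].
have bE a b : hl_br leibniz_of a b = comm a b by [].
have tE a : hl_twist leibniz_of a = al a by [].
have cl a b : comm (al a) b = comm a b by exact: alpha_identity_l.
have cr a b : comm a (al b) = comm a b by exact: alpha_identity_r.
have flip (y b c : A) : box y (comm b c) = - box y (comm c b).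
  by rewrite -linearNr -commC.
split=> [m n n'|n m m'|m m' n|n n' m|m m' n|n n' m|m m' n n'|m m' n n'
        |m m' n n'|m m' n n'];
  rewrite ?(lact_LE, ract_LE) ?(phiA_lact, phiA_ract, brE, alE)
    ?(lcE, rcE, bE, tE) ?phiAE ?cl ?cr ?al_comm //.
- by rewrite box_comm !cl.
- by rewrite -[comm m m']al_comm twist_comm box_comm !cr.
- by rewrite -[comm m m']al_comm twist_comm box_comm3 !cl !cr.
- by rewrite box_comm3 !cl !cr.
Qed.

Definition ev_L : {linear star_A_L -> L_alg} := star_lift ev_L_compatible.

Lemma ev_L_l a x : ev_L (starl _ _ a x) = lact act_A_L a x.
Proof. exact: (star_lift_l ev_L_compatible). Qed.

Lemma ev_L_r x a : ev_L (starr _ _ x a) = ract act_A_L x a.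
Proof. exact: (star_lift_r ev_L_compatible). Qed.

Fact phi_equivariant : equivariant act_A_L act_L_A
  act_A_AA act_AA_A phi.
Proof.
split=> [x y|x|a x|x a|x a|a x] //; apply/val_inj.
- exact: phiAE.
- exact: phi_twistA.
- exact: phiA_lact.
- exact: phiA_ract.
Qed.

Definition star_phi : {linear star_A_L -> star_A_AA} := star_map phi_equivariant.

End AlphaIdentity.

Fact HH_incl_equivariant : equivariant act_A_HH act_HH_A
  act_A_L act_L_A HH_incl.
Proof.
split=> [x y|//|//|//|//|//].
by rewrite [RHS]bcompE !phi_HH linear0r mkBilinearE linear0.
Qed.

Definition star_incl : {linear star_A_HH -> star_A_L} :=
  star_map HH_incl_equivariant.

End HomAssociative.

(* Main.v *)
Require Import Defs.
From mathcomp Require Import all_boot all_algebra.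
From mathcomp Require Import boolp.

Set Implicit Arguments.
Unset Strict Implicit.
Unset Printing Implicit Defensive.

Import GRing.Theory.
Local Open Scope ring_scope.

(** The sequence is the snake sequence of the diagram
<<
      A * HH ---> A * L ---> A * [A, A] ---> 0
        | 0        | ev_L        | ev_AA
  0 --> HH ------> L --phi--> [A, A] ---> 0
>>
    where L is L_alpha(A) and HH is the kernel of phi.  The left vertical map
    is zero because A acts trivially on HH, so its kernel is A * HH and its
    cokernel is HH.  Four facts turn the snake sequence into the stated one.

    - The top row is right exact ([star_map_surj], [exact_star_incl_phi]).
      This is a property of * itself: a generator with an entry in N' lifts to
      M * N along a surjection N -> N', the lift is unique modulo the generators
      with an entry in the kernel, and each of the ten relations lifts to an
      instance of the same relation ([star_map_ker]).
    - The right square commutes ([phi_ev_L]), because ^a l = al a box phi(l)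
      in L and the alpha-identity condition gives [al a, x] = [a, x].
    - The cokernel of [ev_L] is the Milnor-type homology ([exact_ev_L]): the
      image of [ev_L] is spanned by the classes of al a (x) [b, c] and
      [b, c] (x) al a, which are the second and third Milnor relations, while
      the first one already holds in L.
    - The cokernel of [ev_AA] is [A, A] / [A, [A, A]] ([exact_ev_AA]).

    In the snake lemma itself ([snake]), a zero left vertical map lets ev_L
    descend to a map g from A * [A, A] to L.  The connecting map is then the
    restriction of g to the kernel of ev_AA, and no diagram chase is needed to
    define it. *)

(** * The snake lemma with a zero left vertical map *)

Definition surj (U V : Type) (f : U -> V) := forall v, exists u, f u = v.

Section Factor.
Variables (K : fieldType) (U V W : lmodType K).
Variables (p : {linear U -> V}) (f : {linear U -> W}).
Hypotheses (p_surj : surj p) (f_ker : forall u, p u = 0 -> f u = 0).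

Lemma factor_through : exists g : {linear V -> W}, forall u, g (p u) = f u.
Proof.
pose s v := projT1 (cid (p_surj v)).
have sK v : p (s v) = v by rewrite /s; case: cid.
have fsE u : f (s (p u)) = f u.
  by apply/eqP; rewrite -subr_eq0 -linearB f_ker // linearB sK subrr.
suff f_s_linear : linear (f \o s) by exists (mkLinear f_s_linear); exact: fsE.
by move=> a x y /=; rewrite -linearP -[RHS]fsE linearP !sK.
Qed.

End Factor.

Section Snake.
Variables (K : fieldType) (X Y Z L C M Q : lmodType K).
Variables (i : {linear X -> Y}) (p : {linear Y -> Z}) (phi : {linear L -> C}).
Variables (d : {linear Y -> L}) (e : {linear Z -> C}).
Variables (cd : {linear L -> M}) (ce : {linear C -> Q}).
Hypotheses (ip : exact i p) (p_surj : surj p) (phi_surj : surj phi).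
Hypotheses (di0 : forall x, d (i x) = 0) (phid : forall y, phi (d y) = e (p y)).
Hypotheses (dcd : exact d cd) (cd_surj : surj cd).
Hypotheses (ece : exact e ce) (ce_surj : surj ce).

(** The diagram has rows X -> Y -> Z -> 0 and 0 -> ker phi -> L -> C -> 0 and
    vertical maps 0, d, e, whose cokernels are ker phi, M and Q. *)
Theorem snake :
  exists (f1 : {linear X -> subspace (ker d)})
         (f2 : {linear subspace (ker d) -> subspace (ker e)})
         (f3 : {linear subspace (ker e) -> subspace (ker phi)})
         (f4 : {linear subspace (ker phi) -> M})
         (f5 : {linear M -> Q}),
    [/\ forall x, incl _ (f1 x) = i x,
        forall y, incl _ (f2 y) = p (incl _ y),
        forall z y, p y = incl _ z -> incl _ (f3 z) = d y,
        forall h, f4 h = cd (incl _ h) &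
        forall l, f5 (cd l) = ce (phi l)] /\
    [/\ exact f1 f2, exact f2 f3, exact f3 f4, exact f4 f5 & surj f5].
Proof.
have i_in x : i x \in ker d by apply/kerP.
have p_in (y : subspace (ker d)) : lcomp p (incl _) y \in ker e.
  by apply/kerP; rewrite lcompE -phid; have /kerP -> := valP y; rewrite linear0.
(* [d] vanishes on the kernel of [p], so it descends to [g] on the whole of
   [Z]; the connecting map is the restriction of [g]. *)
have [g gE] : exists g : {linear Z -> L}, forall y, g (p y) = d y.
  by apply: factor_through => // y /ip[x <-].
have phig z : phi (g z) = e z by have [y <-] := p_surj z; rewrite gE phid.
have g_in (z : subspace (ker e)) : lcomp g (incl _) z \in ker phi.
  by apply/kerP; rewrite lcompE phig; apply/kerP/valP.
have [f5 f5E] : exists f5 : {linear M -> Q}, forall l, f5 (cd l) = lcomp ce phi l.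
  apply: factor_through => // l /dcd[y <-].
  by rewrite lcompE phid; apply/ece; exists (p y).
exists (corestrict i_in), (corestrict p_in), (corestrict g_in),
  (lcomp cd (incl _)), f5; split; split=> //.
- by move=> z y pyz; rewrite -gE pyz.
- move=> y; split=> [/(congr1 val)/ip[x xy]|[x <-]].
    by exists x; apply: val_inj.
  by apply: val_inj; apply/ip; exists x.
- move=> z; split=> [/(congr1 val) gz0|[y <-]].
    have [y pyz] := p_surj (val z).
    have y_in : y \in ker d by apply/kerP; rewrite -gE pyz.
    by exists (Sub y y_in); apply: val_inj.
  by apply: val_inj; have /kerP dy0 := valP y; exact: etrans (gE _) dy0.
- move=> h; split=> [/dcd[y yh]|[z <-]].
    have py_in : p y \in ker e.
      by apply/kerP; rewrite -phid yh; apply/kerP/valP.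
    by exists (Sub (p y) py_in); apply: val_inj; rewrite /= gE.
  have [y pyz] := p_surj (val z).
  by apply/dcd; exists y; rewrite /= -pyz gE.
- move=> m; split=> [|[h <-]].
    (* If phi l = e z, correct l by the value of [d] on a lift of z: the
       difference lies in the kernel of [phi] and has the same class as l. *)
    have [l <-] := cd_surj m; rewrite f5E => /ece[z ezl].
    have [y pyz] := p_surj z.
    have l_in : l - d y \in ker phi.
      by apply/kerP; rewrite linearB phid pyz ezl subrr.
    exists (Sub (l - d y) l_in).
    rewrite lcompE /= linearB [X in _ - X](_ : _ = 0) ?subr0 //.
    by apply/dcd; exists y.
  by rewrite lcompE f5E lcompE; have /kerP -> := valP h; rewrite linear0.
- move=> q; have [c <-] := ce_surj q; have [l <-] := phi_surj c.
  by exists (cd l).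
Qed.

End Snake.

(** * Right exactness of the non-abelian tensor product *)

Section StarExt.
Variables (K : fieldType) (M N : homLeibniz K).
Variables (aMN : action M N) (aNM : action N M).

Lemma star_ext (W : lmodType K) (f g : {linear star aMN aNM -> W}) :
  (forall m n, f (starl aMN aNM m n) = g (starl aMN aNM m n)) ->
  (forall n m, f (starr aMN aNM n m) = g (starr aMN aNM n m)) ->
  f =1 g.
Proof.
move=> fgl fgr x; have [[s t] <-] := qproj_surj x.
have -> : (s, t) = (s, 0) + (0, t).
  by apply: injective_projections; rewrite /= ?addr0 ?add0r.
rewrite !linearD; congr (_ + _).
- elim/tensor_ind: s => [|a m n s IHs]; first by rewrite !linear0.
  by rewrite pair_linl !linearP IHs; congr (_ *: _ + _); apply: fgl.
- elim/tensor_ind: t => [|a n m t IHt]; first by rewrite !linear0.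
  by rewrite pair_linr !linearP IHt; congr (_ *: _ + _); apply: fgr.
Qed.

End StarExt.

Section StarRightExact.
Variables (K : fieldType) (M N N' : homLeibniz K).
Variables (aMN : action M N) (aNM : action N M).
Variables (aMN' : action M N') (aNM' : action N' M).
Variables (g : {linear N -> N'}) (g_eqv : equivariant aMN aNM aMN' aNM' g).
Hypothesis g_surj : surj g.

Lemma star_map_surj : surj (star_map g_eqv).
Proof.
suff sS w : w \in im (star_map g_eqv) by move=> w; apply/imP.
apply/qproj_eq0.
apply: (@star_ext _ _ _ _ _ _ (qproj (im (star_map g_eqv))) \0) => [m n'|n' m].
  have [n <-] := g_surj n'; apply/qproj_eq0/imP.
  by exists (starl aMN aNM m n); rewrite star_map_l.
have [n <-] := g_surj n'; apply/qproj_eq0/imP.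
by exists (starr aMN aNM n m); rewrite star_map_r.
Qed.

Variable S : submodClosed (star aMN aNM).
Hypothesis Sl : forall m n, g n = 0 -> starl aMN aNM m n \in S.
Hypothesis Sr : forall m n, g n = 0 -> starr aMN aNM n m \in S.

(** Modulo S the generators m * n and n * m depend on n only through g n, so
    they define a map from M * N' to (M * N) / S: its relations are those of
    M * N at arbitrary lifts of the elements of N'.  The composite with
    M * N -> M * N' is the projection, hence the kernel lies in S.
    Leaving S abstract allows it to be the image of a tensor product with any
    algebra structure on the kernel of g, such as the zero bracket on HH. *)
Lemma star_map_ker t : star_map g_eqv t = 0 -> t \in S.
Proof.
pose s n' := projT1 (cid (g_surj n')).
have sK n' : g (s n') = n' by rewrite /s; case: cid.
have gs0 n : g (s (g n) - n) = 0 by rewrite linearB sK subrr.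
pose fl m n' := qproj S (starl aMN aNM m (s n')).
pose fr n' m := qproj S (starr aMN aNM (s n') m).
have flE m n : fl m (g n) = qproj S (starl aMN aNM m n).
  apply/qprojP; have /= <- := linearB (mkLinear (@starl_linr _ _ _ aMN aNM m)).
  exact: Sl.
have frE n m : fr (g n) m = qproj S (starr aMN aNM n m).
  apply/qprojP; have /= <- := linearB (mkLinear (@starr_linl _ _ _ aMN aNM m)).
  exact: Sr.
have fl_linl n' : linear (fl^~ n') by move=> a m m'; rewrite /fl starl_linl linearP.
have fl_linr m : linear (fl m).
  move=> a n1 n2; have [{}n1 <-] := g_surj n1; have [{}n2 <-] := g_surj n2.
  by rewrite -linearP !flE starl_linr linearP.
have fr_linl m : linear (fr^~ m).
  move=> a n1 n2; have [{}n1 <-] := g_surj n1; have [{}n2 <-] := g_surj n2.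
  by rewrite -linearP !frE starr_linl linearP.
have fr_linr n' : linear (fr n') by move=> a m m'; rewrite /fr starr_linr linearP.
have [g_br g_al g_la g_ra g_lc g_rc] := g_eqv.
have fC : star_compatible aMN' aNM' (mkBilinear fl_linl fl_linr)
                                    (mkBilinear fr_linl fr_linr).
  split=> [m n1 n2|n1 m m'|m m' n1|n1 n2 m|m m' n1|n1 n2 m
          |m m' n1 n2|m m' n1 n2|m m' n1 n2|m m' n1 n2]; rewrite !mkBilinearE;
  have [{}n1 <-] := g_surj n1; try (have [{}n2 <-] := g_surj n2);
  rewrite -?(g_br, g_al, g_la, g_ra, g_lc, g_rc) !(flE, frE)
    -?(linearB (qproj S), linearN (qproj S)); congr (qproj S _).
  - exact: star_eq1.
  - exact: star_eq2.
  - exact: star_eq3.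
  - exact: star_eq4.
  - exact: star_eq5.
  - exact: star_eq6.
  - exact: star_eq7.
  - exact: star_eq8.
  - exact: star_eq9.
  - exact: star_eq10.
move=> t0; apply/qproj_eq0.
rewrite -[RHS](linear0 (star_lift fC)) -t0.
apply: (@star_ext _ _ _ _ _ _ (qproj S) (lcomp (star_lift fC) (star_map g_eqv))).
  by move=> m n; rewrite lcompE star_map_l star_lift_l mkBilinearE flE.
by move=> n m; rewrite lcompE star_map_r star_lift_r mkBilinearE frE.
Qed.

End StarRightExact.

(** * The two cokernels and the rows of the diagram *)

Section HochschildMilnor.
Variables (K : fieldType) (A : homAssoc K).

Lemma phi_surj : surj (phi A).
Proof.
move=> [x xS]; suff /imP[l lx] : x \in im (phiA A) by exists l; apply: val_inj.
move: xS => /lspanP; elim=> [_ [a [b ->]]||k y z _ yS _ zS].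
- by apply/imP; exists (box A a b); rewrite phiAE.
- exact: rpred0.
- by rewrite rpredD ?rpredZ.
Qed.

(** The image of [ev_AA] contains [A, [A, A]] by the generators a * x, and the
    generators x * a add nothing because [x, a] = - [a, x]. *)
Lemma exact_ev_AA : exact (ev_AA A) (qproj (A_AA_span A)).
Proof.
move=> y; rewrite qproj_eq0; split=> [/lspanP|[t <-]].
  suff yS : in_span (fun y : commutator_alg A =>
      exists (a : A) (x : commutator_alg A), val y = comm A a (val x)) y ->
      y \in im (ev_AA A) by move=> /yS/imP.
  elim=> [{}y [a [x yE]]||k {}y z _ yS _ zS].
  - apply/imP; exists (starl (act_A_AA A) (act_AA_A A) a x).
    by rewrite ev_AA_l; apply: val_inj.
  - exact: rpred0.
  - by rewrite rpredD ?rpredZ.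
apply/qproj_eq0.
apply: (@star_ext _ _ _ _ _ _ (lcomp (qproj (A_AA_span A)) (ev_AA A)) \0) => [a x|x a];
  apply/qproj_eq0.
  by rewrite ev_AA_l; apply/lspanP/span_gen; exists a, x.
rewrite ev_AA_r -[ract _ _ _]opprK -scaleN1r rpredZ //.
apply/lspanP/span_gen; exists a, x.
by rewrite linearN /= -commC.
Qed.

Lemma milnor_class_b3 a b c :
  let f := bpost (tens A A) (milnor_class A) in
  f (ha_mul A a b) (ha_twist A c) - f (ha_twist A a) (ha_mul A b c)
  + f (ha_mul A c a) (ha_twist A b) = 0.
Proof.
move=> f; rewrite /f !bpostE -linearB -linearD.
by apply/qproj_eq0/lspanP/span_gen; exact: milnor_rel1.
Qed.

Definition L_to_milnor : {linear L_space A -> HH1_Milnor A} :=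
  Llift milnor_class_b3.

Lemma L_to_milnorE t : L_to_milnor (L_class A t) = milnor_class A t.
Proof.
apply: (@tensor_ext _ _ _ _ (lcomp L_to_milnor (L_class A)) (milnor_class A)).
by move=> a b; rewrite lcompE -boxE LliftE.
Qed.

Lemma L_to_milnor_box_al_phiA a l :
  L_to_milnor (box A (ha_twist A a) (phiA A l)) = 0.
Proof.
have L0 b c : L_to_milnor (box A (ha_twist A a) (comm A b c)) = 0.
  rewrite boxE L_to_milnorE commE linearBr.
  by apply/qproj_eq0/lspanP/span_gen; exact: milnor_rel2.
apply: (@box_ext _ _ _ (lcomp L_to_milnor
  (lcomp (mkLinear (linearPr (box A) (ha_twist A a))) (phiA A))) \0) => b c.
by rewrite !lcompE phiAE; exact: L0.
Qed.

Lemma L_to_milnor_box_phiA_al a l :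
  L_to_milnor (box A (phiA A l) (ha_twist A a)) = 0.
Proof.
have L0 b c : L_to_milnor (box A (comm A b c) (ha_twist A a)) = 0.
  rewrite boxE L_to_milnorE commE linearBl.
  by apply/qproj_eq0/lspanP/span_gen; exact: milnor_rel3.
apply: (@box_ext _ _ _ (lcomp L_to_milnor
  (lcomp (mkLinear (linearPl (box A) (ha_twist A a))) (phiA A))) \0) => b c.
by rewrite !lcompE phiAE; exact: L0.
Qed.

Hypothesis hA : alpha_identity A.

(** The values of [ev_L] at a * (b box c) and (b box c) * a are the classes of
    the second and third Milnor relations. *)
Lemma exact_ev_L : exact (ev_L hA) L_to_milnor.
Proof.
have rel2E a b c : box A (ha_twist A a) (comm A b c) =
    ev_L hA (starl (act_A_L A) (act_L_A A) a (box A b c)).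
  by rewrite ev_L_l lact_LE phiAE.
have rel3E a b c : box A (comm A b c) (ha_twist A a) =
    ev_L hA (starr (act_A_L A) (act_L_A A) (box A b c) a).
  by rewrite ev_L_r ract_LE phiAE.
move=> l; split=> [|[t <-]].
  have [t <-] := qproj_surj l.
  move=> /(etrans (esym (L_to_milnorE t)))/qproj_eq0/lspanP t_rel.
  suff /imP : L_class A t \in im (ev_L hA) by [].
  elim: t_rel => {t} [_ [] a b c||k t u _ tS _ uS].
  - by rewrite linearD linearB -!boxE box_b3 rpred0.
  - by rewrite linearB -!boxE -linearBr -commE rel2E; apply/imP; eexists.
  - by rewrite linearB -!boxE -linearBl -commE rel3E; apply/imP; eexists.
  - by rewrite linear0 rpred0.
  - by rewrite linearP rpredD ?rpredZ.
apply: (@star_ext _ _ _ _ _ _ (lcomp L_to_milnor (ev_L hA)) \0) => [a x|x a];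
  rewrite lcompE.
  by rewrite ev_L_l lact_LE; exact: L_to_milnor_box_al_phiA.
by rewrite ev_L_r ract_LE; exact: L_to_milnor_box_phiA_al.
Qed.

Lemma phi_ev_L t : phi A (ev_L hA t) = ev_AA A (star_phi hA t).
Proof.
apply: (@star_ext _ _ _ _ _ _ (lcomp (phi A) (ev_L hA))
  (lcomp (ev_AA A) (star_phi hA))) => [a x|x a]; rewrite !lcompE.
  by rewrite star_map_l ev_L_l ev_AA_l; apply: val_inj; exact: phiA_lact.
by rewrite star_map_r ev_L_r ev_AA_r; apply: val_inj; exact: phiA_ract.
Qed.

Lemma ev_L_star_incl s : ev_L hA (star_incl A s) = 0.
Proof.
apply: (@star_ext _ _ _ _ _ _ (lcomp (ev_L hA) (star_incl A)) \0) => [a h|h a];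
  rewrite lcompE.
  by rewrite star_map_l ev_L_l lact_LE phi_HH linear0r.
by rewrite star_map_r ev_L_r ract_LE phi_HH linear0l.
Qed.

Lemma exact_star_incl_phi : exact (star_incl A) (star_phi hA).
Proof.
move=> t; split=> [t0|[s <-]].
  apply/imP; apply: star_map_ker t0 => [|a x /kerP x0|a x /kerP x0];
    first exact: phi_surj.
    apply/imP; exists (starl (act_A_HH A) (act_HH_A A) a (Sub x x0)).
    by rewrite star_map_l.
  apply/imP; exists (starr (act_A_HH A) (act_HH_A A) (Sub x x0) a).
  by rewrite star_map_r.
apply: (@star_ext _ _ _ _ _ _ (lcomp (star_phi hA) (star_incl A)) \0) => [a h|h a];
  rewrite lcompE.
  rewrite star_map_l [LHS]star_map_l (kerP _ _).1 ?linear0; last exact: valP.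
  exact: (linear0 (mkLinear (@starl_linr _ _ _ (act_A_AA A) (act_AA_A A) a))).
rewrite star_map_r [LHS]star_map_r (kerP _ _).1 ?linear0; last exact: valP.
exact: (linear0 (mkLinear (@starr_linl _ _ _ (act_A_AA A) (act_AA_A A) a))).
Qed.

End HochschildMilnor.

Theorem theorem5p7 (K : fieldType) (A : homAssoc K) (hA : alpha_identity A) :
  exists (f1 : {linear star_A_HH A -> subspace (ker (ev_L hA))})
         (f2 : {linear subspace (ker (ev_L hA)) -> subspace (ker (ev_AA A))})
         (f3 : {linear subspace (ker (ev_AA A)) -> HH1 A})
         (f4 : {linear HH1 A -> HH1_Milnor A})
         (f5 : {linear HH1_Milnor A -> quotient (A_AA_span A)}),
    (* The maps are the natural ones: f1 and f2 are induced by HH1 -> L_alpha(A)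
       and phi, f3 is the connecting map, f4 is induced by the identity of
       A (x) A, and f5 by a (x) b |-> [a, b]. *)
    [/\ forall s, incl _ (f1 s) = star_incl A s,
        forall x, incl _ (f2 x) = star_phi hA (incl _ x),
        forall u t, star_phi hA t = incl _ u -> incl _ (f3 u) = ev_L hA t,
        forall h t, L_class A t = incl _ h -> f4 h = milnor_class A t &
        forall a b, f5 (milnor_class A (tens A A a b)) =
          qproj (A_AA_span A) (phi A (box A a b))] /\
    [/\ exact f1 f2, exact f2 f3, exact f3 f4, exact f4 f5 &
        forall z, exists y, f5 y = z].
Proof.
have milnor_surj : surj (L_to_milnor A).
  move=> m; have [t <-] := qproj_surj m.
  by exists (L_class A t); rewrite L_to_milnorE.
have [f1 [f2 [f3 [f4 [f5 [[f1E f2E f3E f4E f5E] fS]]]]]] :=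
  snake (exact_star_incl_phi hA)
    (star_map_surj (phi_equivariant hA) (@phi_surj K A)) (@phi_surj K A)
    (ev_L_star_incl hA) (phi_ev_L hA) (exact_ev_L hA) milnor_surj
    (@exact_ev_AA K A) (@qproj_surj _ _ _).
exists f1, f2, f3, f4, f5; split=> //; split=> //.
  by move=> h t ht; rewrite f4E -L_to_milnorE ht.
by move=> a b; rewrite -L_to_milnorE f5E.
Qed.
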